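(* Let $\mathscr{Q}$ be a commutative semicartesian quantale, let $\sim$ be a locallic congruence over $\mathscr{Q}$, and let $\otimes$ and $1$ be the associated congruential tensor and congruential tensor unit on the category $\mathscr{Q}\text{-}\mathbf{Set}$ of $\mathscr{Q}$-sets and functional morphisms. Then $(\mathscr{Q}\text{-}\mathbf{Set},\otimes,1)$, with associator $((x,y),z)\mapsto(x,(y,z))$, unitors given by forgetting the coordinate in $1$, and braiding $(x,y)\mapsto(y,x)$, is a symmetric monoidal category.
   Context: A quantale $\mathscr{Q}=(|\mathscr{Q}|,\leq,\otimes)$ is a complete lattice with an associative binary operation $\otimes$ that distributes over arbitrary suprema (including the empty one) in each variable. It is commutative if $\otimes$ is commutative, and semicartesian if $a\otimes b\leq a\wedge b$ for all $a,b$. $\mathrm{E}\mathscr{Q}$ denotes the set of idempotent elements of $\mathscr{Q}$; with the order of $\mathscr{Q}$ it is a locale in which suprema are those of $\mathscr{Q}$ and binary meets are given by $\otimes$. A $\mathscr{Q}$-set is a set $X$ with a map $\delta:X\times X\to\mathscr{Q}$ such that for all $x,y,z\in X$: (1) $\delta(x,y)=\delta(y,x)$; (2) $\delta(x,y)\otimes\delta(y,z)\leq\delta(x,z)$; (3) $\delta(x,x)\otimes\delta(x,y)=\delta(x,y)$. The extent of $x$ is $\mathrm{E}x=\delta(x,x)$, an element of $\mathrm{E}\mathscr{Q}$. A functional morphism $f:X\to Y$ of $\mathscr{Q}$-sets is a function between the underlying sets with $\delta_X(x,x')\leq\delta_Y(f(x),f(x'))$ and $\mathrm{E}f(x)=\mathrm{E}x$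 for all $x,x'\in X$. $\mathscr{Q}\text{-}\mathbf{Set}$ is the category of $\mathscr{Q}$-sets and functional morphisms. A locallic congruence over $\mathscr{Q}$ is an equivalence relation $\sim$ on the locale $\mathrm{E}\mathscr{Q}$ such that: if $I$ is non-empty and $a\sim b_i$ for all $i\in I$ then $a\sim\bigvee_{i\in I}b_i$; and if $a\sim b$ and $a\sim c$ then $a\sim(b\wedge c)$. Congruential tensor: $X\otimes Y=\{(x,y)\in X\times Y:\mathrm{E}x\sim\mathrm{E}y\}$ with $\delta((x,y),(a,b))=\delta_X(x,a)\otimes\delta_Y(y,b)$; on morphisms $f:X\to Y$, $g:A\to B$, $(f\otimes g)(x,a)=(f(x),g(a))$. Congruential tensor unit: $1=\{\sup[a]_\sim : a\in\mathrm{E}\mathscr{Q}\}\subseteq\mathrm{E}\mathscr{Q}$ with $\delta(e,e')=e\otimes e'$, where $[a]_\sim$ is the $\sim$-class of $a$. *)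

(* Defs.v *)
From HB Require Import structures.
From Corelib Require Import RelationClasses.
From mathcomp Require Import all_boot all_order.
From mathcomp Require Import boolp classical_sets.

Set Implicit Arguments.
Unset Strict Implicit.
Unset Printing Implicit Defensive.

Import Order.TTheory.
Local Open Scope classical_set_scope.
Local Open Scope order_scope.

Reserved Notation "a \ox b" (at level 40, left associativity).
Reserved Notation "g \oc f" (at level 50, left associativity).

(* [qsup set0] is the bottom element, so distributivity over [qsup set0] says
   that the bottom element is absorbing.  No unit is required. *)
HB.mixin Record Lattice_isQuantale d T & Order.Lattice d T := {
  qsup : set T -> T;
  qsup_supremum : forall A : set T, supremums A (qsup A);
  qmul : T -> T -> T;
  qmulA : associative qmul;
  qmul_supr : forall (a : T) (A : set T),
    qmul a (qsup A) = qsup [set qmul a b | b in A];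
  qmul_supl : forall (a : T) (A : set T),
    qmul (qsup A) a = qsup [set qmul b a | b in A]
}.

#[short(type="quantaleType")]
HB.structure Definition Quantale d :=
  {T of Lattice_isQuantale d T & Order.Lattice d T}.

Notation "a \ox b" := (qmul a b) : order_scope.

HB.mixin Record Quantale_isComSemicartesian d T & Quantale d T := {
  qmulC : commutative (@qmul d T);
  qmul_le_meet : forall a b : T, qmul a b <= Order.meet a b
}.

#[short(type="csQuantaleType")]
HB.structure Definition ComSemicartesianQuantale d :=
  {T of Quantale_isComSemicartesian d T & Quantale d T}.

(* The set EQ of idempotents, with the order of Q. *)
Record idem d (Q : quantaleType d) :=
  Idem { idem_val :> Q; idemP : idem_val \ox idem_val == idem_val }.

HB.instance Definition _ d (Q : quantaleType d) :=
  [isSub for @idem_val d Q].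
HB.instance Definition _ d (Q : quantaleType d) :=
  [Choice of idem Q by <:].
HB.instance Definition _ d (Q : quantaleType d) :=
  [SubChoice_isSubPOrder of idem Q by <: with d].

(* Suprema and binary meets are those of the poset EQ; they are expressed as
   relations ([supremums A] is the set of least upper bounds of [A], which has
   at most one element, and likewise for [infimums]). *)
Record locallicCongruence d (Q : quantaleType d) := LocallicCongruence {
  lcongr :> idem Q -> idem Q -> Prop;
  lcongr_equiv : Equivalence lcongr;
  lcongr_sup : forall (I : Type) (a : idem Q) (b : I -> idem Q) (s : idem Q),
    inhabited I -> (forall i, lcongr a (b i)) ->
    supremums (range b) s -> lcongr a s;
  lcongr_meet : forall a b c m : idem Q,
    lcongr a b -> lcongr a c -> infimums [set b; c] m -> lcongr a m
}.

Record qset d (Q : quantaleType d) := QSetPack {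
  qcar :> Type;
  delta : qcar -> qcar -> Q;
  deltaC : forall x y, delta x y = delta y x;
  delta_trans : forall x y z, delta x y \ox delta y z <= delta x z;
  delta_extent : forall x y, delta x x \ox delta x y = delta x y
}.
Arguments delta {d Q X} : rename.

Lemma extent_idem d (Q : quantaleType d) (X : qset Q) (x : X) :
  delta x x \ox delta x x == delta x x.
Proof. by rewrite delta_extent. Qed.

Definition extent d (Q : quantaleType d) (X : qset Q) (x : X) : idem Q :=
  Idem (extent_idem x).

Record qmor d (Q : quantaleType d) (X Y : qset Q) := QMor {
  qfun :> X -> Y;
  qfun_delta : forall x x', delta x x' <= delta (qfun x) (qfun x');
  qfun_extent : forall x, extent (qfun x) = extent x
}.

Lemma qmor_eq d (Q : quantaleType d) (X Y : qset Q) (f g : qmor X Y) :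
  (forall x, f x = g x) -> f = g.
Proof.
case: f g => [f fd fe] [g gd ge] /= /funext efg.
by subst g; congr QMor; exact: Prop_irrelevance.
Qed.

Record category := Category {
  obj :> Type;
  hom : obj -> obj -> Type;
  idmor : forall X, hom X X;
  compose : forall X Y Z, hom Y Z -> hom X Y -> hom X Z;
  compose1l : forall X Y (f : hom X Y), compose (idmor Y) f = f;
  compose1r : forall X Y (f : hom X Y), compose f (idmor X) = f;
  composeA : forall X Y Z W (h : hom Z W) (g : hom Y Z) (f : hom X Y),
    compose h (compose g f) = compose (compose h g) f
}.
Arguments hom {C} : rename.
Arguments idmor {C} X : rename.
Notation "g \oc f" := (compose g f).

Definition isIso (C : category) (X Y : C) (f : hom X Y) : Prop :=
  exists g : hom Y X, g \oc f = idmor X /\ f \oc g = idmor Y.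

Section Monoidal.
Variables (C : category) (T : C -> C -> C)
  (T1 : forall X Y A B : C, hom X Y -> hom A B -> hom (T X A) (T Y B)).
Arguments T1 {X Y A B}.

Record isBifunctor : Prop := IsBifunctor {
  bifunctor_id : forall X A : C, T1 (idmor X) (idmor A) = idmor (T X A);
  bifunctor_comp : forall (X Y Z A B D : C) (g : hom Y Z) (f : hom X Y)
      (g' : hom B D) (f' : hom A B),
    T1 (g \oc f) (g' \oc f') = T1 g g' \oc T1 f f'
}.

Variables (I : C)
  (assoc : forall X Y Z : C, hom (T (T X Y) Z) (T X (T Y Z)))
  (lunit : forall X : C, hom (T I X) X)
  (runit : forall X : C, hom (T X I) X).

Record isMonoidal : Prop := IsMonoidal {
  monoidal_bifunctor : isBifunctor;
  assoc_iso : forall X Y Z, isIso (assoc X Y Z);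
  assoc_natural : forall (X X' Y Y' Z Z' : C)
      (f : hom X X') (g : hom Y Y') (h : hom Z Z'),
    assoc X' Y' Z' \oc T1 (T1 f g) h = T1 f (T1 g h) \oc assoc X Y Z;
  lunit_iso : forall X, isIso (lunit X);
  lunit_natural : forall (X X' : C) (f : hom X X'),
    lunit X' \oc T1 (idmor I) f = f \oc lunit X;
  runit_iso : forall X, isIso (runit X);
  runit_natural : forall (X X' : C) (f : hom X X'),
    runit X' \oc T1 f (idmor I) = f \oc runit X;
  monoidal_pentagon : forall X Y Z W : C,
    T1 (idmor X) (assoc Y Z W) \oc assoc X (T Y Z) W
      \oc T1 (assoc X Y Z) (idmor W)
    = assoc X Y (T Z W) \oc assoc (T X Y) Z W;
  monoidal_triangle : forall X Y : C,
    T1 (idmor X) (lunit Y) \oc assoc X I Y = T1 (runit X) (idmor Y)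
}.

Variable braid : forall X Y : C, hom (T X Y) (T Y X).

(* The second hexagon identity follows from the first one and [braid_symmetry]. *)
Record isSymmetricMonoidal : Prop := IsSymmetricMonoidal {
  symmetric_monoidal : isMonoidal;
  braid_iso : forall X Y, isIso (braid X Y);
  braid_natural : forall (X X' Y Y' : C) (f : hom X X') (g : hom Y Y'),
    braid X' Y' \oc T1 f g = T1 g f \oc braid X Y;
  braid_hexagon : forall X Y Z : C,
    assoc Y Z X \oc braid X (T Y Z) \oc assoc X Y Z
    = T1 (idmor Y) (braid X Z) \oc assoc Y X Z \oc T1 (braid X Y) (idmor Z);
  braid_symmetry : forall X Y, braid Y X \oc braid X Y = idmor (T X Y)
}.
End Monoidal.

Section QSet.
Context {d : Order.disp_t} (Q : quantaleType d).

Lemma qmor_id_extent (X : qset Q) (x : X) : extent (id x) = extent x.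
Proof. by []. Qed.

Definition qmor_id (X : qset Q) : qmor X X :=
  @QMor d Q X X id (fun x x' => lexx _) (@qmor_id_extent X).

Lemma qmor_comp_delta (X Y Z : qset Q) (g : qmor Y Z) (f : qmor X Y) x x' :
  delta x x' <= delta (g (f x)) (g (f x')).
Proof. exact: le_trans (qfun_delta f x x') (qfun_delta g _ _). Qed.

Lemma qmor_comp_extent (X Y Z : qset Q) (g : qmor Y Z) (f : qmor X Y) x :
  extent (g (f x)) = extent x.
Proof. by rewrite !qfun_extent. Qed.

Definition qmor_comp (X Y Z : qset Q) (g : qmor Y Z) (f : qmor X Y) :
  qmor X Z := QMor (qmor_comp_delta g f) (qmor_comp_extent g f).

Lemma qmor_comp1l (X Y : qset Q) (f : qmor X Y) :
  qmor_comp (qmor_id Y) f = f.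
Proof. exact: qmor_eq. Qed.

Lemma qmor_comp1r (X Y : qset Q) (f : qmor X Y) :
  qmor_comp f (qmor_id X) = f.
Proof. exact: qmor_eq. Qed.

Lemma qmor_compA (X Y Z W : qset Q) (h : qmor Z W) (g : qmor Y Z)
    (f : qmor X Y) :
  qmor_comp h (qmor_comp g f) = qmor_comp (qmor_comp h g) f.
Proof. exact: qmor_eq. Qed.

Definition QSet : category :=
  Category qmor_comp1l qmor_comp1r qmor_compA.

End QSet.

Section Quantale.
Context {d : Order.disp_t} {Q : csQuantaleType d}.
Implicit Types a b c : Q.

Lemma qsup2 a b : a <= b -> qsup [set a; b] = b.
Proof.
move=> ab; apply: (is_subset1_supremums (A := [set a; b])).
  exact: qsup_supremum.
by split=> [x [->|->]//|y]; apply; right.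
Qed.

Lemma qmul_monor c a b : a <= b -> c \ox a <= c \ox b.
Proof.
move=> ab; rewrite -[in leRHS](qsup2 ab) qmul_supr.
by apply: (qsup_supremum _).1; exists a => //; left.
Qed.

Lemma qmul_mono a b a' b' : a <= b -> a' <= b' -> a \ox a' <= b \ox b'.
Proof.
move=> ab ab'; apply: le_trans (qmul_monor _ ab') _.
by rewrite ![_ \ox b']qmulC; exact: qmul_monor.
Qed.

Lemma qmul_lel a b : a \ox b <= a.
Proof. by have := qmul_le_meet a b; rewrite lexI => /andP[]. Qed.

Lemma qmulACA : interchange (@qmul d Q) (@qmul d Q).
Proof.
move=> a b c e; rewrite -!qmulA; congr (_ \ox _).
by rewrite !qmulA [b \ox c]qmulC.
Qed.

End Quantale.

Section CongruentialTensor.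
Context {d : Order.disp_t} {Q : csQuantaleType d}.
Variable R : locallicCongruence Q.

Definition ctensor_car (X Y : qset Q) : Type :=
  {p : X * Y | R (extent p.1) (extent p.2)}.

Definition tfst (X Y : qset Q) (p : ctensor_car X Y) : X := (sval p).1.
Definition tsnd (X Y : qset Q) (p : ctensor_car X Y) : Y := (sval p).2.

Definition ctensor_delta (X Y : qset Q) (p q : ctensor_car X Y) : Q :=
  delta (tfst p) (tfst q) \ox delta (tsnd p) (tsnd q).

Lemma ctensor_deltaC (X Y : qset Q) (p q : ctensor_car X Y) :
  ctensor_delta p q = ctensor_delta q p.
Proof. by rewrite /ctensor_delta deltaC [X in _ \ox X]deltaC. Qed.

Lemma ctensor_delta_trans (X Y : qset Q) (p q r : ctensor_car X Y) :
  ctensor_delta p q \ox ctensor_delta q r <= ctensor_delta p r.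
Proof.
by rewrite /ctensor_delta qmulACA; apply: qmul_mono; exact: delta_trans.
Qed.

Lemma ctensor_delta_extent (X Y : qset Q) (p q : ctensor_car X Y) :
  ctensor_delta p p \ox ctensor_delta p q = ctensor_delta p q.
Proof. by rewrite /ctensor_delta qmulACA !delta_extent. Qed.

Definition ctensor (X Y : qset Q) : qset Q :=
  QSetPack (@ctensor_deltaC X Y) (@ctensor_delta_trans X Y)
    (@ctensor_delta_extent X Y).

Section Mor.
Variables (X Y A B : qset Q) (f : qmor X Y) (g : qmor A B).

Lemma ctensor_fun_congr (p : ctensor X A) :
  R (extent (f (tfst p))) (extent (g (tsnd p))).
Proof. by rewrite !qfun_extent; exact: svalP p. Qed.

Definition ctensor_fun (p : ctensor X A) : ctensor Y B :=
  exist (fun q : Y * B => R (extent q.1) (extent q.2))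
    (f (tfst p), g (tsnd p)) (ctensor_fun_congr p).

Lemma ctensor_fun_delta (p q : ctensor X A) :
  delta p q <= delta (ctensor_fun p) (ctensor_fun q).
Proof. by apply: qmul_mono; exact: qfun_delta. Qed.

Lemma ctensor_fun_extent (p : ctensor X A) :
  extent (ctensor_fun p) = extent p.
Proof.
apply: val_inj; rewrite /= /ctensor_delta /=; congr (_ \ox _).
  exact: (congr1 (@idem_val d Q) (qfun_extent f (tfst p))).
exact: (congr1 (@idem_val d Q) (qfun_extent g (tsnd p))).
Qed.

Definition ctensor_mor : qmor (ctensor X A) (ctensor Y B) :=
  QMor ctensor_fun_delta ctensor_fun_extent.
End Mor.

Definition cunit_car : Type :=
  {e : idem Q | exists a : idem Q, supremums [set b | R a b] e}.

Definition cunit_delta (e e' : cunit_car) : Q :=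
  idem_val (sval e) \ox idem_val (sval e').

Lemma cunit_deltaC e e' : cunit_delta e e' = cunit_delta e' e.
Proof. exact: qmulC. Qed.

Lemma cunit_delta_trans e e' e'' :
  cunit_delta e e' \ox cunit_delta e' e'' <= cunit_delta e e''.
Proof.
apply: qmul_mono; first exact: qmul_lel.
by rewrite /cunit_delta qmulC; exact: qmul_lel.
Qed.

Lemma cunit_delta_extent e e' :
  cunit_delta e e \ox cunit_delta e e' = cunit_delta e e'.
Proof.
by rewrite /cunit_delta (eqP (idemP _)) qmulA (eqP (idemP _)).
Qed.

Definition cunit : qset Q :=
  QSetPack cunit_deltaC cunit_delta_trans cunit_delta_extent.

End CongruentialTensor.

(* Main.v *)
Require Import Defs.
From mathcomp Require Import all_boot all_order.
From mathcomp Require Import boolp classical_sets.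

Set Implicit Arguments.
Unset Strict Implicit.
Unset Printing Implicit Defensive.

Import Order.TTheory.
Local Open Scope classical_set_scope.
Local Open Scope order_scope.

(** All the structure maps are bijections that preserve [delta] exactly, and a
bijective isometry of Q-sets is an isomorphism ([isometry_iso]).  Equality in a
congruential tensor is equality of both coordinates ([ctensor_eq]), so
naturality and the coherence identities hold coordinatewise, by computation.
What remains is that the structure maps are well defined.

For the associator, [E (x, y)] is the meet [E x \ox E y] of idempotents, and
closure of the congruence under binary meets puts it in the common class of
[E x] and [E y] ([extent_ctensor_congrl], [extent_ctensor_congrr]).  Hence
both bracketings of a triple express that the three extents are congruent.

For the unitors, closure under nonempty suprema puts [sup [a]] in the class of
[a], so that [sup [E x]] is the only element of the unit that is congruent to
[E x] ([cunit_congr_supremum], [cunit_uniq]); it exists because suprema of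
idempotents are idempotent ([qsup_idem]).  As it lies above [E x], it acts on
[delta x x'] as an identity ([idem_absorb_delta]), which makes the projections
isometries. *)

(** * Idempotents of a commutative semicartesian quantale *)

Section Idempotents.
Context {d : Order.disp_t} {Q : csQuantaleType d}.

Lemma qmul_idem (a b : idem Q) :
  (idem_val a \ox idem_val b) \ox (idem_val a \ox idem_val b)
  == idem_val a \ox idem_val b.
Proof. by rewrite qmulACA !(eqP (idemP _)). Qed.

(** The product of two idempotents is their meet among the idempotents: an
idempotent [m] below both is [m \ox m], hence below the product. *)
Lemma qmul_infimums (a b : idem Q) :
  infimums [set a; b] (Idem (qmul_idem a b)).
Proof.
split=> [_ [->|->]|m mab].
- exact: qmul_lel.
- by rewrite -[_ <= _]/(idem_val a \ox idem_val b <= _) qmulC qmul_lel.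
rewrite -[_ <= _]/(idem_val m <= idem_val a \ox idem_val b).
rewrite -(eqP (idemP m)).
by apply: qmul_mono; apply: mab; [left|right].
Qed.

Lemma qsup_idem (A : set (idem Q)) :
  qsup (@idem_val d Q @` A) \ox qsup (@idem_val d Q @` A)
  == qsup (@idem_val d Q @` A).
Proof.
have [ubA lubA] := qsup_supremum (@idem_val d Q @` A).
apply/eqP/le_anti; rewrite qmul_lel /=; apply: lubA => _ [a Aa <-].
by rewrite -(eqP (idemP a)); apply: qmul_mono; apply: ubA; exists a.
Qed.

(** The supremum of a set of idempotents: the supremum taken in the quantale,
which is itself idempotent. *)
Definition idem_sup (A : set (idem Q)) : idem Q := Idem (qsup_idem A).

Lemma idem_sup_supremums (A : set (idem Q)) : supremums A (idem_sup A).
Proof.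
have [ubA lubA] := qsup_supremum (@idem_val d Q @` A).
split=> [a Aa|b bA]; first by apply: ubA; exists a.
by apply: lubA => _ [a Aa <-]; exact: bA.
Qed.

Lemma idem_absorb_delta (X : qset Q) (e : idem Q) (x y : X) :
  extent x <= e -> idem_val e \ox delta x y = delta x y.
Proof.
move=> xe; apply/le_anti; rewrite {1}qmulC qmul_lel /=.
by rewrite -[in leLHS](delta_extent x y); exact: qmul_mono.
Qed.

End Idempotents.

(** * Isometries of Q-sets *)

Section Isometries.
Context {d : Order.disp_t} {Q : csQuantaleType d}.

Section Mor.
Variables (X Y : qset Q) (f : X -> Y)
  (fd : forall x x', delta (f x) (f x') = delta x x').

Lemma isometry_le x x' : delta x x' <= delta (f x) (f x').
Proof. by rewrite fd. Qed.

Lemma isometry_extent x : extent (f x) = extent x.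
Proof. exact/val_inj/fd. Qed.

(** The functional morphism given by a map that preserves [delta] exactly. *)
Definition isometry_mor : qmor X Y := QMor isometry_le isometry_extent.
End Mor.

Lemma isometry_iso (X Y : qset Q) (f : X -> Y) (g : Y -> X)
    (fd : forall x x', delta (f x) (f x') = delta x x') :
  cancel f g -> cancel g f -> @isIso (QSet Q) X Y (isometry_mor fd).
Proof.
move=> fK gK.
have gd y y' : delta (g y) (g y') = delta y y' by rewrite -fd !gK.
exists (isometry_mor gd : @hom (QSet Q) Y X).
by split; apply: qmor_eq => z /=; rewrite ?fK ?gK.
Qed.

End Isometries.

(** * Structure maps of the congruential tensor *)

Section StructureMaps.
Context {d : Order.disp_t} {Q : csQuantaleType d}.
Variable R : locallicCongruence Q.

Lemma lcongr_refl a : R a a.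
Proof. by case: (lcongr_equiv R) => r _ _; exact: r. Qed.

Lemma lcongr_sym a b : R a b -> R b a.
Proof. by case: (lcongr_equiv R) => _ s _; exact: s. Qed.

Lemma lcongr_trans b a c : R a b -> R b c -> R a c.
Proof. by case: (lcongr_equiv R) => _ _ t; exact: t. Qed.

(** The supremum of a congruence class belongs to the class; the class is
nonempty because it contains [a]. *)
Lemma lcongr_supremum (a s : idem Q) : supremums [set b | R a b] s -> R a s.
Proof.
move=> sP; pose I := {b : idem Q | R a b}.
have rangeE : range (fun i : I => sval i) = [set b | R a b].
  by apply/seteqP; split=> [_ [[b Rab] _ <-]//|b Rab]; exists (exist _ b Rab).
apply: (@lcongr_sup d Q R I a (fun i : I => sval i)); last by rewrite rangeE.
  exact: inhabits (exist (fun b => R a b) a (lcongr_refl a)).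
by case.
Qed.

Section Pairs.
Variables X Y : qset Q.

(** The element [(x, y)] of the tensor, for congruent extents. *)
Definition tpair (x : X) (y : Y) (xy : R (extent x) (extent y)) :
    ctensor R X Y :=
  exist (fun q : X * Y => R (extent q.1) (extent q.2)) (x, y) xy.

Lemma ctensor_eq (p q : ctensor R X Y) :
  tfst p = tfst q -> tsnd p = tsnd q -> p = q.
Proof.
case: p q => [[x y] p] [[x' y'] q]; rewrite /tfst /tsnd /= => ex ey; subst.
by congr exist; exact: Prop_irrelevance.
Qed.

Lemma ctensor_congr (p : ctensor R X Y) :
  R (extent (tfst p)) (extent (tsnd p)).
Proof. exact: svalP p. Qed.

Lemma extent_ctensor_congrl (p : ctensor R X Y) :
  R (extent (tfst p)) (extent p).
Proof.
apply: (lcongr_meet (lcongr_refl _) (ctensor_congr p)).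
have -> : extent p = Idem (qmul_idem (extent (tfst p)) (extent (tsnd p))).
  exact: val_inj.
exact: qmul_infimums.
Qed.

Lemma extent_ctensor_congrr (p : ctensor R X Y) :
  R (extent (tsnd p)) (extent p).
Proof.
apply: lcongr_trans (extent_ctensor_congrl p).
exact: lcongr_sym (ctensor_congr p).
Qed.

End Pairs.

Section Associator.
Variables X Y Z : qset Q.

Section Forward.
Variable t : ctensor R (ctensor R X Y) Z.

Lemma assoc_congr2 : R (extent (tsnd (tfst t))) (extent (tsnd t)).
Proof.
exact: lcongr_trans (extent_ctensor_congrr (tfst t)) (ctensor_congr t).
Qed.

Lemma assoc_congr1 : R (extent (tfst (tfst t))) (extent (tpair assoc_congr2)).
Proof.
apply: lcongr_trans (ctensor_congr (tfst t)) _.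
exact: (extent_ctensor_congrl (tpair assoc_congr2)).
Qed.

(** The associator [((x, y), z) |-> (x, (y, z))]. *)
Definition assoc_fun : ctensor R X (ctensor R Y Z) := tpair assoc_congr1.
End Forward.

Section Backward.
Variable t : ctensor R X (ctensor R Y Z).

Lemma unassoc_congr1 : R (extent (tfst t)) (extent (tfst (tsnd t))).
Proof.
apply: lcongr_trans (ctensor_congr t) _.
exact: lcongr_sym (extent_ctensor_congrl (tsnd t)).
Qed.

Lemma unassoc_congr2 :
  R (extent (tpair unassoc_congr1)) (extent (tsnd (tsnd t))).
Proof.
apply: lcongr_trans (ctensor_congr (tsnd t)).
exact: lcongr_sym (extent_ctensor_congrr (tpair unassoc_congr1)).
Qed.

(** Its inverse [(x, (y, z)) |-> ((x, y), z)]. *)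
Definition unassoc_fun : ctensor R (ctensor R X Y) Z := tpair unassoc_congr2.
End Backward.

Lemma assoc_funK : cancel assoc_fun unassoc_fun.
Proof. by move=> t; apply: ctensor_eq => //; exact: ctensor_eq. Qed.

Lemma unassoc_funK : cancel unassoc_fun assoc_fun.
Proof. by move=> t; apply: ctensor_eq => //; exact: ctensor_eq. Qed.

Lemma assoc_delta t t' : delta (assoc_fun t) (assoc_fun t') = delta t t'.
Proof. exact: qmulA. Qed.

End Associator.

Section Braiding.
Variables X Y : qset Q.

(** The braiding [(x, y) |-> (y, x)]. *)
Definition braid_fun (t : ctensor R X Y) : ctensor R Y X :=
  tpair (lcongr_sym (ctensor_congr t)).

Lemma braid_delta t t' : delta (braid_fun t) (braid_fun t') = delta t t'.
Proof. exact: qmulC. Qed.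

End Braiding.

Lemma braid_funK (X Y : qset Q) :
  cancel (@braid_fun X Y) (@braid_fun Y X).
Proof. by move=> t; exact: ctensor_eq. Qed.

Section Unitors.
Implicit Type X : qset Q.

Lemma extent_cunit (e : cunit R) : extent e = sval e.
Proof. exact/val_inj/eqP/idemP. Qed.

Lemma cunit_eq (e e' : cunit R) : sval e = sval e' -> e = e'.
Proof.
case: e e' => [e p] [e' q] /= ee'; subst.
by congr exist; exact: Prop_irrelevance.
Qed.

(** An element of the unit is the supremum of every class that it is congruent
to, whichever representative [b] witnesses its membership. *)
Lemma cunit_congr_supremum (e : cunit R) a :
  R (extent e) a -> supremums [set b | R a b] (sval e).
Proof.
rewrite extent_cunit => ea; case: (svalP e) => b eb.
suff -> : [set c | R a c] = [set c | R b c] by [].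
have ba : R b a := lcongr_trans (lcongr_supremum eb) ea.
apply/seteqP; split=> c /=; first exact: lcongr_trans.
exact/lcongr_trans/lcongr_sym.
Qed.

Lemma cunit_uniq (e e' : cunit R) a :
  R (extent e) a -> R (extent e') a -> e = e'.
Proof.
move=> /cunit_congr_supremum ea /cunit_congr_supremum e'a.
exact/cunit_eq/(is_subset1_supremums ea e'a).
Qed.

Lemma le_cunit (e : cunit R) a : R (extent e) a -> a <= sval e.
Proof. by move=> /cunit_congr_supremum[ub _]; exact/ub/lcongr_refl. Qed.

(** The element [sup [a]] of the tensor unit. *)
Definition cunit_sup (a : idem Q) : cunit R :=
  exist (fun e => exists a, supremums [set b | R a b] e)
    (idem_sup [set b | R a b]) (ex_intro _ a (idem_sup_supremums _)).

Lemma cunit_sup_congr a : R (extent (cunit_sup a)) a.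
Proof.
rewrite extent_cunit; apply/lcongr_sym/lcongr_supremum.
exact: idem_sup_supremums.
Qed.

Lemma lunit_delta X (t t' : ctensor R (cunit R) X) :
  delta (tsnd t) (tsnd t') = delta t t'.
Proof.
rewrite -[RHS]/((idem_val (sval (tfst t)) \ox idem_val (sval (tfst t')))
  \ox delta (tsnd t) (tsnd t')) -qmulA.
have le1 (p : ctensor R (cunit R) X) : extent (tsnd p) <= sval (tfst p).
  exact/le_cunit/ctensor_congr.
(* With [t = (e, x)] and [t' = (e', x')]: symmetry brings [x'] to the left of
   [delta], where [e' >= E x'] is absorbed, and then [x], where [e] is. *)
rewrite [delta (tsnd t) _]deltaC (idem_absorb_delta _ (le1 t')) deltaC.
by rewrite (idem_absorb_delta _ (le1 t)).
Qed.

(** The inverse [x |-> (sup [E x], x)] of the left unitor. *)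
Definition lunit_inv X (x : X) : ctensor R (cunit R) X :=
  tpair (cunit_sup_congr (extent x)).

Lemma lunit_invK X : cancel (@lunit_inv X) (@tsnd d Q R (cunit R) X).
Proof. by []. Qed.

Lemma lunitK X : cancel (@tsnd d Q R (cunit R) X) (@lunit_inv X).
Proof.
move=> t; apply: ctensor_eq => //.
exact: cunit_uniq (cunit_sup_congr _) (ctensor_congr t).
Qed.

Lemma runit_delta X (t t' : ctensor R X (cunit R)) :
  delta (tfst t) (tfst t') = delta t t'.
Proof. by rewrite -braid_delta -lunit_delta. Qed.

(** The inverse of the right unitor, obtained from the left one by braiding. *)
Definition runit_inv X (x : X) : ctensor R X (cunit R) :=
  braid_fun (lunit_inv x).

Lemma runit_invK X : cancel (@runit_inv X) (@tfst d Q R X (cunit R)).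
Proof. by []. Qed.

Lemma runitK X : cancel (@tfst d Q R X (cunit R)) (@runit_inv X).
Proof.
move=> t; rewrite -[RHS]braid_funK; congr braid_fun.
exact: (lunitK (braid_fun t)).
Qed.

End Unitors.

Lemma ctensor_bifunctor :
  @isBifunctor (QSet Q) (ctensor R) (@ctensor_mor d Q R).
Proof. by split=> *; apply: qmor_eq => t; exact: ctensor_eq. Qed.

Definition assoc_mor X Y Z := isometry_mor (@assoc_delta X Y Z).
Definition lunit_mor X := isometry_mor (@lunit_delta X).
Definition runit_mor X := isometry_mor (@runit_delta X).
Definition braid_mor X Y := isometry_mor (@braid_delta X Y).

Lemma ctensor_monoidal :
  @isMonoidal (QSet Q) (ctensor R) (@ctensor_mor d Q R) (cunit R)
    assoc_mor lunit_mor runit_mor.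
Proof.
split.
- exact: ctensor_bifunctor.
- move=> X Y Z.
  exact: isometry_iso (@assoc_funK X Y Z) (@unassoc_funK X Y Z).
- move=> *; apply: qmor_eq => t.
  by apply: ctensor_eq => //; exact: ctensor_eq.
- move=> X.
  exact: isometry_iso (@lunit_delta X) (@lunitK X) (@lunit_invK X).
- by move=> *; exact: qmor_eq.
- move=> X.
  exact: isometry_iso (@runit_delta X) (@runitK X) (@runit_invK X).
- by move=> *; exact: qmor_eq.
- move=> *; apply: qmor_eq => t.
  by apply: ctensor_eq => //; apply: ctensor_eq => //; exact: ctensor_eq.
- by move=> *; apply: qmor_eq => t; exact: ctensor_eq.
Qed.

Lemma ctensor_symmetric_monoidal :
  @isSymmetricMonoidal (QSet Q) (ctensor R) (@ctensor_mor d Q R) (cunit R)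
    assoc_mor lunit_mor runit_mor braid_mor.
Proof.
split.
- exact: ctensor_monoidal.
- by move=> X Y; exact: isometry_iso (@braid_funK X Y) (@braid_funK Y X).
- by move=> *; apply: qmor_eq => t; exact: ctensor_eq.
- move=> *; apply: qmor_eq => t.
  by apply: ctensor_eq => //; exact: ctensor_eq.
- by move=> *; apply: qmor_eq => t; exact: ctensor_eq.
Qed.

End StructureMaps.

Theorem mainTheorem11 (d : Order.disp_t) (Q : csQuantaleType d)
    (R : locallicCongruence Q) :
  exists (assoc : forall X Y Z : qset Q,
            qmor (ctensor R (ctensor R X Y) Z) (ctensor R X (ctensor R Y Z)))
         (lunit : forall X : qset Q, qmor (ctensor R (cunit R) X) X)
         (runit : forall X : qset Q, qmor (ctensor R X (cunit R)) X)
         (braid : forall X Y : qset Q, qmor (ctensor R X Y) (ctensor R Y X)),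
    (forall (X Y Z : qset Q) (t : ctensor R (ctensor R X Y) Z),
        tfst (assoc X Y Z t) = tfst (tfst t) /\
        tfst (tsnd (assoc X Y Z t)) = tsnd (tfst t) /\
        tsnd (tsnd (assoc X Y Z t)) = tsnd t) /\
    (forall (X : qset Q) (t : ctensor R (cunit R) X), lunit X t = tsnd t) /\
    (forall (X : qset Q) (t : ctensor R X (cunit R)), runit X t = tfst t) /\
    (forall (X Y : qset Q) (t : ctensor R X Y),
        tfst (braid X Y t) = tsnd t /\ tsnd (braid X Y t) = tfst t) /\
    @isSymmetricMonoidal (QSet Q) (ctensor R) (@ctensor_mor d Q R) (cunit R)
      assoc lunit runit braid.
Proof.
exists (@assoc_mor d Q R), (@lunit_mor d Q R), (@runit_mor d Q R).
exists (@braid_mor d Q R); do 4!split=> //.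
exact: ctensor_symmetric_monoidal.
Qed.
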